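(* Increased ambiguity decreases the value of the optimal policy and shrinks the continuation region: if $\hat\kappa>\kappa>0$, then $V_{\hat\kappa}(\mathbf{x})\le V_\kappa(\mathbf{x})$ for all $\mathbf{x}\in\mathbb{R}^d$, and $C_{\hat\kappa}\subseteq C_\kappa$.
   Context: Let $d\ge 2$ and let $\mathbf{W}$ be a $d$-dimensional standard Brownian motion under the measure $\mathbb{P}$, with $\mathbf{X}_t=\mathbf{x}+\mathbf{W}_t$, $\mathbf{x}\in\mathbb{R}^d$. For $\kappa>0$ (the degree of ambiguity), $\mathcal{P}^\kappa$ denotes the set of all probability measures $\mathbb{Q}^{\boldsymbol\theta}$ equivalent to $\mathbb{P}$ with density process $\frac{d\mathbb{Q}^{\boldsymbol\theta}}{d\mathbb{P}}\big|_{\mathcal{F}_t}=\mathcal{M}^{\boldsymbol\theta}_t=\exp\left(-\int_0^t\boldsymbol\theta_s\,d\mathbf{W}_s-\frac12\int_0^t\|\boldsymbol\theta_s\|^2ds\right)$, where $\{\boldsymbol\theta_t\}_{t\ge0}$ is a progressively measurable $\mathbb{R}^d$-valued process satisfying $\|\boldsymbol\theta_t\|^2\le\kappa^2$ for all $t\ge 0$ (Euclidean norm). Let $r>0$ be the discount rate, let $F:\mathbb{R}^d\to\mathbb{R}$ be a measurable function, and let $\mathcal{T}$ be the set of all stopping times (possibly taking the value $\infty$). Define $$V_\kappa(\mathbf{x})=\sup_{\tau\in\mathcal{T}}\ \inf_{\mathbb{Q}^{\boldsymbol\theta}\in\mathcal{P}^\kappa}\mathbb{E}^{\mathbb{Q}^{\boldsymbol\theta}}_{\mathbf{x}}\left[e^{-r\tau}F(\mathbf{X}_\tau)\mathbf{1}_{\{\tau<\infty\}}\right],\qquad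 C_\kappa=\{\mathbf{x}\in\mathbb{R}^d: V_\kappa(\mathbf{x})>F(\mathbf{x})\}.$$ *)

(* Defs.v *)
From HB Require Import structures.
From mathcomp Require Import all_boot all_order all_algebra.
From mathcomp Require Import all_classical all_reals all_analysis.
Set Implicit Arguments.
Unset Strict Implicit.
Unset Printing Implicit Defensive.
Import Order.TTheory GRing.Theory Num.Theory.
Import numFieldNormedType.Exports.
Local Open Scope classical_set_scope.
Local Open Scope ring_scope.

(* MathComp's norm on row vectors is the sup norm, hence the explicit Euclidean
   inner product: [dot u u] is the squared Euclidean norm. *)
Definition dot (R : realType) (d : nat) (u v : 'rV[R]_d) : R :=
  \sum_(i < d) u 0 i * v 0 i.

Definition borel (T : topologicalType) : set (set T) := <<s (@open T) >>.

(* Measurability relative to explicit sigma-algebras (e.g. a member of a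
   filtration), which are not canonical structures on the types. *)
Definition measurable_wrt (T U : Type) (G : set (set T)) (H : set (set U))
    (f : T -> U) : Prop :=
  forall B, H B -> G (f @^-1` B).

(* Continuous time is [0, +oo[: families indexed by R are only ever looked at
   for nonnegative times. No completeness or right-continuity is assumed. *)
Record filtration (R : realType) (disp : measure_display)
    (Omega : measurableType disp) (Ft : R -> set (set Omega)) : Prop := {
  filtration_sigma_algebra : forall t : R, 0 <= t -> sigma_algebra setT (Ft t) ;
  filtration_measurable : forall t : R, 0 <= t -> Ft t `<=` measurable ;
  filtration_nondecreasing : forall s t : R, 0 <= s -> s <= t -> Ft s `<=` Ft t }.

(* Standard d-dimensional Brownian motion relative to a filtration; the second
   argument of [normal_prob] is the standard deviation. *)
Record brownian_motion (R : realType) (disp : measure_display)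
    (Omega : measurableType disp) (P : probability Omega R) (d : nat)
    (Ft : R -> set (set Omega)) (W : R -> Omega -> 'rV[R]_d) : Prop := {
  bm_adapted : forall t : R, 0 <= t ->
    measurable_wrt (Ft t) (@borel 'rV[R]_d) (W t) ;
  bm_start : {ae P, forall w, W 0 w = 0} ;
  bm_continuous : forall w, {within `[0, +oo[, continuous (fun t => W t w)} ;
  bm_independent_increments : forall s t : R, 0 <= s -> s < t ->
    forall (A : set Omega) (B : set 'rV[R]_d), Ft s A -> borel B ->
    P (A `&` [set w | B (W t w - W s w)]) =
      (P A * P [set w | B (W t w - W s w)%R])%E ;
  bm_normal_increments : forall s t : R, 0 <= s -> s < t ->
    forall B : 'I_d -> set R, (forall i, measurable (B i)) ->
    P [set w | forall i, B i ((W t w - W s w) 0 i)] =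
      (\prod_(i < d) normal_prob 0%R (Num.sqrt (t - s)%R) (B i))%E }.

Definition progressively_measurable (R : realType) (disp : measure_display)
    (Omega : measurableType disp) (d : nat) (Ft : R -> set (set Omega))
    (theta : R -> Omega -> 'rV[R]_d) : Prop :=
  forall t : R, 0 <= t -> forall B : set 'rV[R]_d, borel B ->
    <<s `[0, t] `*` setT,
        [set C | exists (A : set R) (E : set Omega),
           [/\ measurable A, A `<=` `[0, t], Ft t E & C = A `*` E]] >>
      [set p : R * Omega | p.1 \in `[0, t] /\ B (theta p.1 p.2)].

(* The elementary process
     sum_(i < sp_size) sp_val i * 1_(]sp_time i, sp_time i.+1]). *)
Record simple_process (R : realType) (disp : measure_display)
    (Omega : measurableType disp) (d : nat) (Ft : R -> set (set Omega)) := {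
  sp_size : nat ;
  sp_time : nat -> R ;
  sp_val : nat -> Omega -> 'rV[R]_d ;
  sp_time_ge0 : forall i, 0 <= sp_time i ;
  sp_time_nondecreasing : forall i, sp_time i <= sp_time i.+1 ;
  sp_val_measurable : forall i,
    measurable_wrt (Ft (sp_time i)) (@borel 'rV[R]_d) (sp_val i) ;
  sp_val_bounded : forall i, exists c : R, forall w,
    dot (sp_val i w) (sp_val i w) <= c }.

Definition simple_eval (R : realType) (disp : measure_display)
    (Omega : measurableType disp) (d : nat) (Ft : R -> set (set Omega))
    (phi : simple_process d Ft) (s : R) (w : Omega) : 'rV[R]_d :=
  \sum_(i < sp_size phi | sp_time phi i < s <= sp_time phi i.+1) sp_val phi i w.

Definition simple_integral (R : realType) (disp : measure_display)
    (Omega : measurableType disp) (d : nat) (Ft : R -> set (set Omega))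
    (W : R -> Omega -> 'rV[R]_d) (phi : simple_process d Ft)
    (t : R) (w : Omega) : R :=
  \sum_(i < sp_size phi)
     dot (sp_val phi i w)
         (W (Num.min (sp_time phi i.+1) t) w - W (Num.min (sp_time phi i) t) w).

(* I is (a version of) the Ito integral process t |-> int_0^t theta_s dW_s:
   adapted, almost surely continuous, and the L^2 limit of the integrals of
   simple processes approximating theta in L^2([0, T] x Omega) for every T.
   Continuity is only almost sure because the filtration need not be complete. *)
Definition ito_integral (R : realType) (disp : measure_display)
    (Omega : measurableType disp) (P : probability Omega R) (d : nat)
    (Ft : R -> set (set Omega)) (W theta : R -> Omega -> 'rV[R]_d)
    (I : R -> Omega -> R) : Prop :=
  [/\ forall t : R, 0 <= t -> measurable_wrt (Ft t) measurable (I t),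
      {ae P, forall w, {within `[0, +oo[, continuous (fun t => I t w)}} &
      exists phi : nat -> simple_process d Ft,
        (forall T : R, 0 <= T ->
          (\int[P]_w \int[lebesgue_measure]_(s in `[0%R, T])
             (let e := simple_eval (phi n) s w - theta s w in dot e e)%R%:E)%E
            @[n --> \oo] --> 0%E) /\
        (forall t : R, 0 <= t ->
          'E_P[fun w => ((I t w - simple_integral W (phi n) t w) ^+ 2)%R]%E
            @[n --> \oo] --> 0%E)].

(* The exponential M^theta_t, given the Ito integral process I of theta. *)
Definition density_process (R : realType) (disp : measure_display)
    (Omega : measurableType disp) (d : nat) (theta : R -> Omega -> 'rV[R]_d)
    (I : R -> Omega -> R) (t : R) (w : Omega) : R :=
  expR (- I t w - 2^-1 *
    Rintegral lebesgue_measure `[0, t] (fun s => dot (theta s w) (theta s w))).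

(* The set P^kappa. On the infinite time horizon equivalence of Q and P, like
   the density itself, is understood on each F_t: already for a constant
   nonzero theta, Q^theta and P are singular on the sigma-algebra generated by
   all the F_t. *)
Definition ambiguity_set (R : realType) (disp : measure_display)
    (Omega : measurableType disp) (P : probability Omega R) (d : nat)
    (Ft : R -> set (set Omega)) (W : R -> Omega -> 'rV[R]_d) (kappa : R) :
    set (probability Omega R) :=
  [set Q |
    (forall t : R, 0 <= t -> forall A, Ft t A -> (Q A = 0%E <-> P A = 0%E)) /\
    exists theta I,
      [/\ progressively_measurable Ft theta,
          forall (t : R) w, 0 <= t -> dot (theta t w) (theta t w) <= kappa ^+ 2,
          ito_integral P Ft W theta I &
          forall t : R, 0 <= t -> forall A, Ft t A ->
            Q A = (\int[P]_(w in A) (density_process theta I t w)%:E)%E]].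

Definition stopping_time (R : realType) (disp : measure_display)
    (Omega : measurableType disp) (Ft : R -> set (set Omega)) :
    set (Omega -> \bar R) :=
  [set tau | (forall w, (0 <= tau w)%E) /\
             (forall t : R, 0 <= t -> Ft t [set w | (tau w <= t%:E)%E])].

(* e^(-r tau) F(X_tau) 1_{tau < oo}. *)
Definition payoff (R : realType) (Omega : Type) (d : nat) (r : R)
    (F : 'rV[R]_d -> R) (X : R -> Omega -> 'rV[R]_d) (tau : Omega -> \bar R)
    (w : Omega) : R :=
  if tau w is t%:E then expR (- (r * t)) * F (X t w) else 0.

(* V_kappa is extended-real valued; as in the library's integral, expectations
   follow the convention +oo - +oo = -oo (F is only assumed measurable). *)
Definition value_function (R : realType) (disp : measure_display)
    (Omega : measurableType disp) (P : probability Omega R) (d : nat)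
    (Ft : R -> set (set Omega)) (W : R -> Omega -> 'rV[R]_d) (r : R)
    (F : 'rV[R]_d -> R) (kappa : R) (x : 'rV[R]_d) : \bar R :=
  ereal_sup
    [set ereal_inf
           [set 'E_Q[payoff r F (fun t w => (x + W t w)%R) tau]%E
           | Q in ambiguity_set P Ft W kappa]
    | tau in stopping_time Ft].

Definition continuation_region (R : realType) (disp : measure_display)
    (Omega : measurableType disp) (P : probability Omega R) (d : nat)
    (Ft : R -> set (set Omega)) (W : R -> Omega -> 'rV[R]_d) (r : R)
    (F : 'rV[R]_d -> R) (kappa : R) : set 'rV[R]_d :=
  [set x | (value_function P Ft W r F kappa x > (F x)%:E)%E].

(* Main.v *)
Require Import Defs.
From HB Require Import structures.
From mathcomp Require Import all_boot all_order all_algebra.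
From mathcomp Require Import all_classical all_reals all_analysis.
Import Order.TTheory GRing.Theory Num.Theory.
Import numFieldNormedType.Exports.
Local Open Scope classical_set_scope.
Local Open Scope ring_scope.

(** The degree of ambiguity enters only through the bound on [theta], so raising it enlarges the set
    of measures ([ambiguity_set_le]). For each fixed stopping time the infimum can then only drop,
    and since the stopping times are the same for every degree, the supremum keeps this order
    ([value_function_le]). The reward [F x] stays fixed, so the continuation region shrinks. *)

Lemma ambiguity_set_le (R : realType) (disp : measure_display)
    (Omega : measurableType disp) (P : probability Omega R) (d : nat)
    (Ft : R -> set (set Omega)) (W : R -> Omega -> 'rV[R]_d) (k1 k2 : R) :
  0 <= k1 -> k1 <= k2 ->
  ambiguity_set P Ft W k1 `<=` ambiguity_set P Ft W k2.
Proof.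
move=> k1_ge0 le_k12 Q [QP [theta [I [theta_prog theta_le ito_I densQ]]]].
(* The same [theta] and [I] witness membership for [k2]; only the norm bound has to be relaxed. *)
split=> //; exists theta, I; split=> // t w t0.
(* Squaring preserves order between nonnegative numbers, hence [0 <= k1]. *)
by apply: le_trans (theta_le t w t0) _; rewrite lerXn2r ?nnegrE// (le_trans k1_ge0).
Qed.

Lemma value_function_le (R : realType) (disp : measure_display)
    (Omega : measurableType disp) (P : probability Omega R) (d : nat)
    (Ft : R -> set (set Omega)) (W : R -> Omega -> 'rV[R]_d) (r : R)
    (F : 'rV[R]_d -> R) (k1 k2 : R) (x : 'rV[R]_d) :
  0 <= k1 -> k1 <= k2 ->
  (value_function P Ft W r F k2 x <= value_function P Ft W r F k1 x)%E.
Proof.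
move=> k1_ge0 le_k12; apply: ge_ereal_sup => _ [tau tau_st <-].
(* The same [tau] competes in the supremum for [k1], which leaves two infima to compare. *)
apply: le_trans (ereal_sup_ubound _); last by exists tau.
exact/ereal_inf_le_tmp/image_subset/ambiguity_set_le.
Qed.

Theorem lemma2p1 (R : realType) (disp : measure_display)
    (Omega : measurableType disp) (P : probability Omega R)
    (d : nat) (hd : (2 <= d)%N)
    (Ft : R -> set (set Omega)) (hFt : filtration Ft)
    (W : R -> Omega -> 'rV[R]_d) (hW : brownian_motion P Ft W)
    (r : R) (hr : 0 < r)
    (F : 'rV[R]_d -> R) (hF : measurable_wrt (@borel 'rV[R]_d) measurable F)
    (kappa kappa_hat : R) (hkappa : 0 < kappa) (hlt : kappa < kappa_hat) :
  (forall x : 'rV[R]_d,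
     (value_function P Ft W r F kappa_hat x <= value_function P Ft W r F kappa x)%E) /\
  continuation_region P Ft W r F kappa_hat `<=` continuation_region P Ft W r F kappa.
Proof.
have le_V x : (value_function P Ft W r F kappa_hat x <=
               value_function P Ft W r F kappa x)%E.
  by apply: value_function_le; apply: ltW.
(* The inclusion is the chain from [F x] through the value at [kappa_hat] to that at [kappa]. *)
by split=> // x /lt_le_trans; apply.
Qed.
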